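(* Fix an integer $k\ge 3$ and $\epsilon>0$. For $n$ divisible by $3$, consider the family of graphs $\mathsf{G}_k^{\mu,\upsilon}(\mathbf{X})$ (defined in the context) over all $\mathbf{X}\in\{0,1\}^{n/3\times n/3}$ and $\mu,\upsilon\in\{0,1\}^{n/3}$, each having $\mathsf{n}=kn/3$ nodes. There exists no non-interactive $\epsilon$-edge locally differentially private algorithm that estimates the number of $k$-cliques $K_k$ in every graph $\mathsf{G}_k^{\mu,\upsilon}(\mathbf{X})$ with expected $\ell_2$-error $o(\mathsf{n}^{k-1})$ (as $n\to\infty$, uniformly over $\mathbf{X},\mu,\upsilon$).
   Context: Graph $\mathsf{G}_k^{\mu,\upsilon}(\mathbf{X})$: the vertex set is the disjoint union of $k$ sets $\mathsf{U}=\{\mathsf{u}_1,\dots,\mathsf{u}_{n/3}\}$, $\mathsf{Y}=\{\mathsf{y}_1,\dots,\mathsf{y}_{n/3}\}$, and $\mathsf{W}_p=\{\mathsf{w}_{p,1},\dots,\mathsf{w}_{p,n/3}\}$ for $1\le p\le k-2$. Its edges are exactly: $\{\mathsf{u}_i,\mathsf{y}_j\}$ iff $\mathbf{X}_{i,j}=1$; $\{\mathsf{u}_i,\mathsf{w}_{p,j}\}$ for all $p,j$ iff $\mu_i=1$; $\{\mathsf{y}_i,\mathsf{w}_{p,j}\}$ for all $p,j$ iff $\upsilon_i=1$; and $\{\mathsf{w}_{p,i},\mathsf{w}_{q,j}\}$ for all $i,j$ and all $p\ne q$. There are no other edges. Each node (user) knows only its own adjacency vector (a 0-1 vector indicating its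 neighbors). Two adjacency vectors are neighboring if they differ in exactly one bit. A randomized mechanism $\mathcal{R}$ is $\epsilon$-edge locally differentially private if for all neighboring $a,a'$ and all measurable $S$, $\Pr[\mathcal{R}(a)\in S]\le e^{\epsilon}\Pr[\mathcal{R}(a')\in S]$. A non-interactive $\epsilon$-edge locally differentially private algorithm is one in which each node $v$ applies, once, an $\epsilon$-edge locally differentially private randomizer $\mathcal{L}_v$ to its adjacency vector (independently of other users' responses) and sends $\mathcal{L}_v(a_v)$ to a server, which outputs an aggregate function of all the reports. The expected $\ell_2$-error of an estimate $\tilde K$ of a true value $K$ is $\sqrt{\mathbb{E}[(\tilde K - K)^2]}$. *)

(* Defs.v *)
From HB Require Import structures.
From mathcomp Require Import all_boot all_order all_algebra.
From mathcomp Require Import all_classical all_reals all_analysis.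

Set Implicit Arguments.
Unset Strict Implicit.
Unset Printing Implicit Defensive.
Import Order.TTheory GRing.Theory Num.Theory.
Local Open Scope ring_scope.

(* The graph G_k^{mu,ups}(X).  With m = n/3, the vertex set is        *)
(* 'I_k * 'I_m : vertex (p, i) is                                     *)
(*    u_i       if p = 0,                                             *)
(*    y_i       if p = 1,                                             *)
(*    w_{p-1,i} if 2 <= p <= k-1   (so W_1, ..., W_{k-2}).            *)
Definition Gedge (k m : nat) (X : 'I_m -> 'I_m -> bool) (mu ups : 'I_m -> bool)
  : rel ('I_k * 'I_m) :=
  fun x y =>
    let: (p, i) := x in
    let: (q, j) := y in
    if (p == 0 :> nat) then
      (if (q == 1 :> nat) then X i j else if (2 <= q)%N then mu i else false)
    else if (p == 1 :> nat) then
      (if (q == 0 :> nat) then X j i else if (2 <= q)%N then ups i else false)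
    else
      (if (q == 0 :> nat) then mu j
       else if (q == 1 :> nat) then ups j
       else (p != q)).

Definition adj_vec (V : finType) (e : rel V) (v : V) : {ffun V -> bool} :=
  [ffun w => e v w].

Definition num_cliques (V : finType) (e : rel V) (k : nat) : nat :=
  #|[set S : {set V} | (#|S| == k) &&
       [forall x in S, forall y in S, (x != y) ==> e x y]]|.

Definition neighboring (V : finType) (a a' : {ffun V -> bool}) : Prop :=
  #|[set w | a w != a' w]| = 1%N.

Definition edge_LDP (R : realType) (d : measure_display) (T : measurableType d)
    (V : finType) (eps : R) (L : {ffun V -> bool} -> probability T R) : Prop :=
  forall a a' : {ffun V -> bool}, neighboring a a' ->
  forall S : set T, measurable S ->
    (L a S <= (expR eps)%:E * L a' S)%E.

(* Integration against the product of a finite list of probability    *)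
(* measures (independent reports), as an iterated integral:           *)
(*   iter_int [:: P1; ...; PN] f                                      *)
(*     = \int[P1]_y1 ... \int[PN]_yN f [:: y1; ...; yN].              *)
Fixpoint iter_int (R : realType) (d : measure_display) (T : measurableType d)
    (Ps : seq (probability T R)) (f : seq T -> \bar R) : \bar R :=
  match Ps with
  | [::] => f [::]
  | P :: Ps' => (\int[P]_y iter_int Ps' (fun ys => f (y :: ys)))%E
  end.

Definition expected_sq_error (R : realType) (d : measure_display)
    (T : measurableType d) (V : finType) (e : rel V)
    (L : V -> {ffun V -> bool} -> probability T R)
    (g : #|V|.-tuple T -> R) (K : R) : \bar R :=
  iter_int [seq L (enum_val i) (adj_vec e (enum_val i)) | i <- enum 'I_#|V| ]
    (fun s => match @insub _ _ (#|V|.-tuple T) s with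
              | Some t => ((g t - K) ^+ 2)%:E
              | None => 0%E
              end).

(* Main.v *)
Require Import Defs.
From HB Require Import structures.
From mathcomp Require Import all_boot all_order all_algebra.
From mathcomp Require Import all_classical all_reals all_analysis.
From mathcomp Require Import measurable_realfun ring lra.
Import Order.TTheory GRing.Theory Num.Theory.
Local Open Scope ring_scope.

(* The number of k-cliques of G(X, mu, ups) is m^(k-2) * (mu^T X ups), and each
   u_i only sees row i of X and the bit mu_i, each y_j only sees column j and
   ups_j, and the w's do not see X at all.  Hence one can sample in advance the
   two possible reports of every u_i and y_j, together with the reports of the
   w's for every (mu, ups), and evaluate the server on this common sample for
   all queries (mu, ups) at once.  Averaging these answers against the signs
   (-1)^(mu_i) (-1)^(ups_j) estimates X_ij; by Bessel's inequality the total
   squared error of these m^2 estimates is o(m^2) if all answers have squared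
   error o(m^(2(k-1))).  But flipping X_ij changes the law of only four sampled
   reports, each by a factor at most e^eps, so on average over X the squared
   error of a single estimate is at least (1/2) / (1 + e^(4 eps)). *)

(** * Integration of functions of independent reports *)

Section IteratedIntegral.
Context {R : realType} {d : measure_display} {T : measurableType d}.
Local Open Scope ereal_scope.
Implicit Types (Ps : seq (probability T R)) (f h : seq T -> \bar R).

(** Measurability is asked on lists of length [n] only, seen as points of the product space of
    tuples. *)
Definition smeasurable (n : nat) f :=
  measurable_fun [set: n.-tuple T] (fun t : n.-tuple T => f t).

Lemma iter_int_ext Ps f h :
  (forall s, size s = size Ps -> f s = h s) -> iter_int Ps f = iter_int Ps h.
Proof.
elim: Ps f h => [|P Ps IH] f h fh /=; first exact: fh.
by apply: eq_integral => y _; apply: IH => s ss; apply: fh; rewrite /= ss.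
Qed.

Lemma integral_probability_cst (P : probability T R) r : \int[P]_y cst r y = r.
Proof.
transitivity (r * P setT); last by rewrite probability_setT mule1.
by apply: integral_cst.
Qed.

Lemma iter_int_cst Ps r : iter_int Ps (cst r) = r.
Proof.
elim: Ps => [//|P Ps IH] /=.
by rewrite -[RHS](integral_probability_cst P); apply: eq_integral.
Qed.

Lemma iter_int_ge0 Ps f : (forall s, 0 <= f s) -> 0 <= iter_int Ps f.
Proof.
elim: Ps f => [//|P Ps IH] f f0 /=; first exact: f0.
by apply: integral_ge0 => y _; apply: IH.
Qed.

(* Unused reports integrate to 1, so no measurability is needed. *)
Lemma iter_int_filter {J : Type} (P : J -> probability T R) (p : pred J)
    (js : seq J) f :
  iter_int [seq P j | j <- js & p j] f
  = iter_int [seq P j | j <- js] (fun s => f (mask [seq p j | j <- js] s)).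
Proof.
elim: js f => [//|j js IH] f /=; case: (p j) => /=.
  by apply: eq_integral => y _; rewrite IH.
by rewrite IH -[LHS](integral_probability_cst (P j)); apply: eq_integral.
Qed.

(** The parameter space [A] makes the induction on [Ps] work: the first report joins the parameter
    as a point of [A * T], and Tonelli's theorem gives measurability once it is integrated out. *)
Lemma measurable_iter_int {d'} {A : measurableType d'} Ps (F : A -> seq T -> \bar R) :
  (forall a s, 0 <= F a s) ->
  measurable_fun [set: A * (size Ps).-tuple T] (fun x => F x.1 x.2) ->
  measurable_fun [set: A] (fun a => iter_int Ps (F a)).
Proof.
elim: Ps d' A F => [|P Ps IH] d' A F F0 mF /=.
  have -> : (fun a => F a [::]) = (fun x : A * 0.-tuple T => F x.1 x.2) \o
      (fun a => (a, [tuple])) by [].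
  by apply: measurableT_comp => //; exact: measurable_fun_pair.
pose G (x : A * T) := iter_int Ps (fun s => F x.1 (x.2 :: s)).
apply: (@measurable_fun_fubini_tonelli_F _ _ A T R P G) => [|x]; last first.
  by apply: iter_int_ge0.
apply: (IH _ (A * T)%type (fun x s => F x.1 (x.2 :: s))) => [a s|]; first exact: F0.
have -> : (fun x : (A * T) * (size Ps).-tuple T => F x.1.1 (x.1.2 :: x.2)) =
    (fun x : A * (size Ps).+1.-tuple T => F x.1 x.2) \o
    (fun x : (A * T) * (size Ps).-tuple T => (x.1.1, cons_tuple x.1.2 x.2)) by [].
apply: measurableT_comp => //; apply: measurable_fun_pair.
  exact: measurableT_comp.
by apply: measurable_cons => //; exact: measurableT_comp.
Qed.

Lemma smeasurable_cons n f y : smeasurable n.+1 f -> smeasurable n (fun s => f (y :: s)).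
Proof.
move=> mf; rewrite /smeasurable.
have -> : (fun t : n.-tuple T => f (y :: t)) =
   (fun t : n.+1.-tuple T => f t) \o (fun t : n.-tuple T => cons_tuple y t) by [].
by apply: measurableT_comp => //; apply: measurable_cons.
Qed.

Lemma smeasurable_iter_int Ps f : (forall s, 0 <= f s) ->
  smeasurable (size Ps).+1 f ->
  measurable_fun [set: T] (fun y => iter_int Ps (fun s => f (y :: s))).
Proof.
move=> f0 mf; apply: (@measurable_iter_int _ _ _ (fun y s => f (y :: s))) => //.
have -> : (fun x : T * (size Ps).-tuple T => f (x.1 :: x.2)) =
   (fun t : (size Ps).+1.-tuple T => f t) \o
   (fun x : T * (size Ps).-tuple T => cons_tuple x.1 x.2) by [].
by apply: measurableT_comp => //; apply: measurable_cons.
Qed.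

(** Masking acts on tuples as a map whose coordinates are projections. *)
Lemma smeasurable_mask (b : bitseq) f :
  smeasurable (count id b) f -> smeasurable (size b) (fun s => f (mask b s)).
Proof.
move=> mf; rewrite /smeasurable.
pose js := mask b (enum 'I_(size b)).
have sjs : size js = count id b by rewrite size_mask// size_enum_ord.
pose h (t : (size b).-tuple T) : (count id b).-tuple T :=
  tcast sjs [tuple of map (tnth t) (in_tuple js)].
have hE t : h t = mask b t :> seq T.
  by rewrite /h val_tcast /= map_mask map_tnth_enum.
have -> : (fun t : (size b).-tuple T => f (mask b t)) =
    (fun t : (count id b).-tuple T => f t) \o h.
  by apply/funext => t /=; rewrite hE.
apply: measurableT_comp => //; apply/measurable_fun_tnthP => i.
pose j := tnth (in_tuple js) (cast_ord (esym sjs) i).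
rewrite (_ : _ \o _ = (fun t => tnth t j)); first exact: measurable_tnth.
by apply/funext => t /=; rewrite /h tcastE tnth_map.
Qed.

Lemma ge0_le_iter_int Ps f h : (forall s, 0 <= f s) ->
  smeasurable (size Ps) f -> smeasurable (size Ps) h ->
  (forall s, f s <= h s) -> iter_int Ps f <= iter_int Ps h.
Proof.
elim: Ps f h => [|P Ps IH] f h f0 mf mh fh /=; first exact: fh.
have h0 s : 0 <= h s by exact: le_trans (f0 s) (fh s).
apply: ge0_le_integral => //; try exact: smeasurable_iter_int.
  by move=> y _; exact: iter_int_ge0.
by move=> y _; apply: IH => //; exact: smeasurable_cons.
Qed.

Lemma ge0_iter_intD Ps f h : (forall s, 0 <= f s) -> (forall s, 0 <= h s) ->
  smeasurable (size Ps) f -> smeasurable (size Ps) h ->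
  iter_int Ps (fun s => f s + h s) = iter_int Ps f + iter_int Ps h.
Proof.
elim: Ps f h => [//|P Ps IH] f h f0 h0 mf mh /=.
rewrite -ge0_integralD//; try exact: smeasurable_iter_int; last first.
- by move=> y _; exact: iter_int_ge0.
- by move=> y _; exact: iter_int_ge0.
by apply: eq_integral => y _; apply: IH => //; exact: smeasurable_cons.
Qed.

Lemma ge0_iter_int_sum {I : Type} (r : seq I) Ps (F : I -> seq T -> \bar R) :
  (forall i s, 0 <= F i s) -> (forall i, smeasurable (size Ps) (F i)) ->
  iter_int Ps (fun s => \sum_(i <- r) F i s) = \sum_(i <- r) iter_int Ps (F i).
Proof.
move=> F0 mF; elim: r => [|i r IH].
  rewrite big_nil -[RHS](iter_int_cst Ps).
  by apply: iter_int_ext => s _; rewrite big_nil.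
rewrite big_cons -IH -ge0_iter_intD//.
- by apply: iter_int_ext => s _; rewrite big_cons.
- by move=> s; exact: sume_ge0.
- by apply: emeasurable_sum.
Qed.

Lemma ge0_iter_intZl Ps f (k : R) : (0 <= k)%R -> (forall s, 0 <= f s) ->
  smeasurable (size Ps) f ->
  iter_int Ps (fun s => k%:E * f s) = k%:E * iter_int Ps f.
Proof.
move=> k0; elim: Ps f => [//|P Ps IH] f f0 mf /=.
rewrite -ge0_integralZl_EFin//; try exact: smeasurable_iter_int; last first.
  by move=> y _; exact: iter_int_ge0.
by apply: eq_integral => y _; apply: IH => //; exact: smeasurable_cons.
Qed.

Lemma ge0_integral_le_scale (P Q : probability T R) (c : R) (phi : T -> \bar R) :
  (0 <= c)%R -> (forall S, measurable S -> P S <= c%:E * Q S) ->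
  (forall y, 0 <= phi y) -> measurable_fun [set: T] phi ->
  \int[P]_y phi y <= c%:E * \int[Q]_y phi y.
Proof.
move=> c0 PQ phi0 mphi.
rewrite -[c]/((NngNum c0)%:num)%R -ge0_integral_mscale//.
by apply: ge0_le_measure_integral => // S mS; exact: PQ.
Qed.

(** Domination tensorizes: the inner integrals are compared by induction, and exchanging the outer
    measure costs one more factor [c j]. *)
Lemma iter_int_le_scale {J : Type} (P Q : J -> probability T R) (c : J -> R)
    (js : seq J) f :
  (forall j, 0 <= c j)%R ->
  (forall j S, measurable S -> P j S <= (c j)%:E * Q j S) ->
  (forall s, 0 <= f s) -> smeasurable (size js) f ->
  iter_int (map P js) f <= (\prod_(j <- js) c j)%:E * iter_int (map Q js) f.
Proof.
move=> c0 PQ; elim: js f => [|j js IH] f f0 mf /=; first by rewrite big_nil mul1e.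
have prod0 : (0 <= \prod_(i <- js) c i)%R by exact: prodr_ge0.
have mint (W : J -> probability T R) :
    measurable_fun [set: T] (fun y => iter_int (map W js) (fun s => f (y :: s))).
  by apply: smeasurable_iter_int; rewrite ?size_map.
rewrite big_cons mulrC EFinM -muleA.
apply: (@le_trans _ _ (\int[P j]_y
    ((\prod_(i <- js) c i)%:E * iter_int (map Q js) (fun s => f (y :: s))))).
  apply: ge0_le_integral => //.
  - by move=> y _; exact: iter_int_ge0.
  - exact: measurable_funeM.
  - by move=> y _; apply: IH => //; exact: smeasurable_cons.
rewrite ge0_integralZl_EFin//; last by move=> y _; exact: iter_int_ge0.
apply: lee_wpmul2l; first by rewrite lee_fin.
by apply: ge0_integral_le_scale => //= [S|y]; [exact: PQ | exact: iter_int_ge0].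
Qed.

End IteratedIntegral.

(** * Counting the k-cliques of the graph *)

Section Cliques.
Local Open Scope nat_scope.

(** Fixing the first two values of [phi] as [i] and [j] leaves [m ^ n] functions: their indicator is
    the product of the [G i j p (phi p)], so the count factors over the coordinates. *)
Lemma sum_ffun_two (n m : nat) (F : 'I_m -> 'I_m -> nat) :
  \sum_(phi : {ffun 'I_n.+2 -> 'I_m}) F (phi ord0) (phi (lift ord0 ord0))
  = m ^ n * \sum_i \sum_j F i j.
Proof.
pose G (i j : 'I_m) (p : 'I_n.+2) (x : 'I_m) : nat :=
  if p == ord0 then (x == i : nat) else if p == lift ord0 ord0 then (x == j : nat) else 1.
have sumG i j : \sum_(phi : {ffun 'I_n.+2 -> 'I_m}) \prod_p G i j p (phi p) = m ^ n.
  have sum_eq1 (l : 'I_m) : \sum_x (x == l : nat) = 1.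
    by rewrite (bigD1 l)//= eqxx big1 ?addn0// => x /negbTE ->.
  rewrite -(bigA_distr_bigA (G i j)) 2!big_ord_recl /G /= !sum_eq1 !mul1n.
  by under eq_bigr do rewrite sum_nat_const muln1 card_ord; rewrite prod_nat_const card_ord.
rewrite big_distrr /=; under [RHS]eq_bigr do rewrite big_distrr /=.
under [RHS]eq_bigr => i _ do under eq_bigr => j _ do
  rewrite -(sumG i j) big_distrl /=.
under [RHS]eq_bigr do rewrite exchange_big /=.
rewrite exchange_big /=; apply: eq_bigr => phi _.
under eq_bigr => i _ do under eq_bigr => j _ do rewrite 2!big_ord_recl /G /=.
rewrite (bigD1 (phi ord0)) //= (bigD1 (phi (lift ord0 ord0))) //= !eqxx.
rewrite !mul1n big1 ?mul1n => [|p _]; last by [].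
rewrite big1 ?addn0 => [|j jn]; last by rewrite eq_sym (negbTE jn).
rewrite big1 ?addn0// => i iN; rewrite big1// => j _.
by rewrite eq_sym (negbTE iN).
Qed.

Lemma Gedge_same_part {k m : nat} X mu ups (p : 'I_k) (i j : 'I_m) :
  Gedge X mu ups (p, i) (p, j) = false.
Proof. by rewrite /Gedge; case: p => [[|[|p]] hp] //=; rewrite eqxx. Qed.

Definition selection {k m : nat} (phi : {ffun 'I_k -> 'I_m}) : {set 'I_k * 'I_m} :=
  [set (p, phi p) | p : 'I_k].

Lemma in_selection {k m} (phi : {ffun 'I_k -> 'I_m}) x :
  (x \in selection phi) = (x.2 == phi x.1).
Proof.
apply/imsetP/eqP => [[p _ ->] //|e]; exists x.1 => //.
by rewrite -e -surjective_pairing.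
Qed.

Lemma selection_inj {k m} : injective (@selection k m).
Proof.
move=> phi psi e; apply/ffunP => p; apply/eqP.
by rewrite -[_ == _](in_selection psi (p, phi p)) -e in_selection.
Qed.

(** No edge joins two vertices of one part, so a clique of size [k] meets each of the [k] parts
    exactly once and is a [selection]. Whether a selection is a clique depends only on its first two
    vertices; the other [k - 2] are free. *)
Lemma num_cliques_Gedge (k m : nat) X mu ups : 3 <= k ->
  num_cliques (@Gedge k m X mu ups) k
  = m ^ (k - 2) * \sum_i \sum_j (X i j && (mu i && ups j)).
Proof.
case: k => [|[|[|n]]] // _; rewrite /num_cliques !subSS subn0.
pose p0 : 'I_n.+3 := ord0; pose p1 : 'I_n.+3 := lift ord0 ord0.
pose p2 : 'I_n.+3 := lift ord0 (lift ord0 ord0).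
rewrite -(sum_ffun_two n.+1 m (fun i j => nat_of_bool (X i j && (mu i && ups j)))).
rewrite -/p0 -/p1.
have -> : \sum_(phi : {ffun 'I_n.+3 -> 'I_m}) 
      (X (phi p0) (phi p1) && (mu (phi p0) && ups (phi p1))) =
    #|[set phi : {ffun 'I_n.+3 -> 'I_m} |
        X (phi p0) (phi p1) && (mu (phi p0) && ups (phi p1))]|.
  by rewrite -sum1dep_card [RHS]big_mkcond; apply: eq_bigr => phi _; case: ifP.
rewrite -(card_imset _ selection_inj); apply: eq_card => S; rewrite inE.
apply/andP/imsetP => [[/eqP cS /forall_inP clS]|[phi phiC ->]].
  have edgeS x y : x \in S -> y \in S -> x != y -> Gedge X mu ups x y.
    by move=> xS yS; move/forall_inP: (clS x xS) => /(_ y yS) /implyP.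
  have fst_inj : {in S &, injective fst}.
    move=> [p i] [q j] xS yS /= pq; apply/eqP; apply/negPn/negP => xy.
    by have := edgeS _ _ xS yS xy; rewrite -pq Gedge_same_part.
  have fstS : fst @: S = [set: 'I_n.+3].
    by apply/eqP; rewrite eqEcard finset.subsetT /= (card_in_imset fst_inj) cS cardsT card_ord.
  have exS p : {i | (p, i) \in S}.
    apply/sigW; have : p \in fst @: S by rewrite fstS inE.
    by case/imsetP => -[q i] qS /= ->; exists i.
  pose phi := [ffun p => sval (exS p)].
  have phiS p : (p, phi p) \in S by rewrite ffunE; exact: (svalP (exS p)).
  exists phi; last first.
    apply/setP => -[p i]; rewrite in_selection /=; apply/idP/eqP => [pS|-> //].
    by have := fst_inj _ _ pS (phiS p) erefl; case.
  (* The part [p2] is a W part, present because [k] is at least 3. Its edges to [p0] and [p1] force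
     the bits of [mu] and [ups]; the edge from [p0] to [p1] forces the entry of [X]. *)
  rewrite inE; have := edgeS _ _ (phiS p0) (phiS p1) isT.
  have := edgeS _ _ (phiS p0) (phiS p2) isT.
  have := edgeS _ _ (phiS p1) (phiS p2) isT.
  by rewrite /Gedge /= => -> -> ->.
rewrite inE in phiC; case/and3P: phiC => phiX phimu phiups.
split; first by rewrite card_imset ?card_ord// => p q [].
apply/forall_inP => -[p i]; rewrite in_selection /= => /eqP ->.
apply/forall_inP => -[q j]; rewrite in_selection /= => /eqP ->.
apply/implyP => pq; have {}pq : p != q by apply: contraNneq pq => ->.
have E0 (r : 'I_n.+3) : (r == 0 :> nat) -> r = p0 by move=> /eqP r0; apply/val_inj.
have E1 (r : 'I_n.+3) : (r == 1 :> nat) -> r = p1 by move=> /eqP r1; apply/val_inj.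
rewrite /Gedge; case: ifPn => [/E0 ep|p0N].
  subst p; case: ifPn => [/E1 -> //|q1]; case: ifPn => // q2.
  by case: q pq q1 q2 => [[|[|q]] hq].
case: ifPn => [/E1 ep|p1N].
  subst p; case: ifPn => [/E0 -> //|q1]; case: ifPn => // q2.
  by case: q pq q1 q2 => [[|[|q]] hq].
case: ifPn => [/E0 -> //|_]; case: ifPn => [/E1 -> //|_].
exact: pq.
Qed.

End Cliques.

(** * Orthogonal signs and Bessel's inequality *)

Section Bessel.
Context {R : realFieldType}.

(** The squared norm of [N * D] minus [\sum_i a i * chi i] is nonnegative, and by orthogonality it
    equals [N] times the difference of the two sides. *)
Lemma bessel {I Q : finType} (chi : I -> Q -> R) (N : R) (D : Q -> R) : 0 < N ->
  (forall i i', \sum_q chi i q * chi i' q = N *+ (i == i')) ->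
  \sum_i (\sum_q chi i q * D q) ^+ 2 <= N * \sum_q D q ^+ 2.
Proof.
move=> N0 orth; pose a i := \sum_q chi i q * D q.
rewrite -/(a _); pose A := \sum_i a i ^+ 2; rewrite -/A.
have cross : \sum_q D q * \sum_i a i * chi i q = A.
  under eq_bigr do rewrite big_distrr /=.
  rewrite exchange_big; apply: eq_bigr => i _; rewrite expr2 {2}/a big_distrr /=.
  by apply: eq_bigr => q _; rewrite mulrCA [D q * _]mulrC.
have square : \sum_q (\sum_i a i * chi i q) ^+ 2 = N * A.
  under eq_bigr do rewrite expr2 big_distrlr /=.
  rewrite exchange_big /= big_distrr /=; apply: eq_bigr => i _.
  rewrite exchange_big /= (bigD1 i)//= [X in _ + X]big1 ?addr0 => [|i' ii'].
    under eq_bigr do rewrite mulrACA -expr2.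
    by rewrite -big_distrr/= orth eqxx mulrC.
  under eq_bigr do rewrite mulrACA.
  by rewrite -big_distrr/= orth eq_sym (negbTE ii') mulr0.
have : 0 <= \sum_q (N * D q - \sum_i a i * chi i q) ^+ 2.
  by apply: sumr_ge0 => q _; exact: sqr_ge0.
have expand x y : (N * x - y) ^+ 2 = N ^+ 2 * x ^+ 2 - (2 * N) * (x * y) + y ^+ 2 by ring.
under eq_bigr do rewrite expand.
rewrite big_split sumrB /= -!big_distrr /= square cross.
have -> B : N ^+ 2 * B - 2 * N * A + N * A = N * (N * B - A) by ring.
by rewrite pmulr_rge0// subr_ge0.
Qed.

Definition flip {I : finType} (i : I) (mu : {ffun I -> bool}) : {ffun I -> bool} :=
  [ffun l => (l == i) (+) mu l].

Lemma flipK {I : finType} (i : I) : involutive (flip i).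
Proof. by move=> mu; apply/ffunP => l; rewrite !ffunE addbA addbb. Qed.

(** Flipping bit [i] permutes the vectors and negates every term, so the sum is its own opposite. *)
Lemma sum_sign {I : finType} (i : I) : \sum_(mu : {ffun I -> bool}) (-1) ^+ mu i = 0 :> R.
Proof.
set s := LHS; suff : s = - s by move/eqP; rewrite -addr_eq0 -mulr2n mulrn_eq0 => /eqP.
rewrite {1}/s (reindex_inj (inv_inj (flipK i))) /= -sumrN; apply: eq_bigr => mu _.
by rewrite ffunE eqxx; case: (mu i) => /=; rewrite ?expr0 ?expr1 ?opprK.
Qed.

Lemma sum_sign2 {I : finType} (i i' : I) :
  \sum_(mu : {ffun I -> bool}) (-1) ^+ mu i * (-1) ^+ mu i' = 2 ^+ #|I| *+ (i == i') :> R.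
Proof.
case: eqVneq => [<-|ii'].
  under eq_bigr do rewrite -signr_addb addbb expr0.
  by rewrite sumr_const card_ffun card_bool natrX.
set s := LHS; suff : s = - s by move/eqP; rewrite -addr_eq0 -mulr2n mulrn_eq0 => /eqP.
rewrite {1}/s (reindex_inj (inv_inj (flipK i))) /= -sumrN; apply: eq_bigr => mu _.
rewrite !ffunE eqxx eq_sym (negbTE ii') /= -mulNr; congr (_ * _).
by case: (mu i) => /=; rewrite ?expr0 ?expr1 ?opprK.
Qed.

(** A bit b is 1/2 - (-1)^b / 2; the constant sums to zero against a sign, and orthogonality handles
    the rest. *)
Lemma sum_sign_bit {I : finType} (i i' : I) :
  \sum_(mu : {ffun I -> bool}) (-1) ^+ mu i * (mu i')%:R
  = - (2 ^+ #|I| / 2) *+ (i == i') :> R.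
Proof.
have bitE (b : bool) : b%:R = 2^-1 - (-1) ^+ b / 2 :> R.
  by case: b; rewrite /= ?expr1 ?expr0 ?mulr1n ?mulr0n; field.
under eq_bigr do rewrite bitE mulrBr mulrA.
by rewrite sumrB -!big_distrl /= sum_sign sum_sign2 mul0r sub0r mulrnAl mulNrn.
Qed.

(** A Walsh character of (mu, ups), of degree one in each argument. *)
Definition outer_sign {m : nat} (ij : 'I_m * 'I_m)
    (q : {ffun 'I_m -> bool} * {ffun 'I_m -> bool}) : R :=
  (-1) ^+ q.1 ij.1 * (-1) ^+ q.2 ij.2.

Lemma outer_sign_orthogonal {m : nat} (ij ij' : 'I_m * 'I_m) :
  \sum_q outer_sign ij q * outer_sign ij' q = 4 ^+ m *+ (ij == ij').
Proof.
rewrite -(pair_big predT predT (fun mu ups => outer_sign ij (mu, ups) * outer_sign ij' (mu, ups))) /=.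
under eq_bigr do under eq_bigr do rewrite /outer_sign /= mulrACA.
rewrite -big_distrlr /= !sum_sign2 card_ord mulrnAl mulrnAr -mulrnA mulnb -exprMn.
by rewrite andbC -xpair_eqE -!surjective_pairing -natrM.
Qed.

(** The sums over mu and ups separate, and each vanishes unless its index agrees with [ij]; the
    surviving term carries two factors -2^m / 2. *)
Lemma outer_sign_query {m : nat} (ij : 'I_m * 'I_m) (X : 'I_m * 'I_m -> bool) :
  \sum_q outer_sign ij q *
     (\sum_i \sum_j (X (i, j) && (q.1 i && q.2 j)))%N%:R
  = 4 ^+ m / 4 * (X ij)%:R.
Proof.
under eq_bigr => q _.
  rewrite natr_sum big_distrr /=.
  under eq_bigr => i _.
    rewrite natr_sum big_distrr /=.
    under eq_bigr do rewrite -!mulnb !natrM /outer_sign mulrCA mulrACA.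
    over.
  over.
rewrite exchange_big /=; under eq_bigr do rewrite exchange_big /=.
have inner i j : \sum_(q : {ffun 'I_m -> bool} * {ffun 'I_m -> bool})
    (X (i, j))%:R * ((-1) ^+ q.1 ij.1 * (q.1 i)%:R * ((-1) ^+ q.2 ij.2 * (q.2 j)%:R))
    = 4 ^+ m / 4 * (X (i, j))%:R *+ (ij == (i, j)) :> R.
  move: (X (i, j))%:R => x.
  rewrite -big_distrr /= -(pair_big predT predT (fun mu ups : {ffun 'I_m -> bool} =>
    (-1) ^+ mu ij.1 * (mu i)%:R * ((-1) ^+ ups ij.2 * (ups j)%:R))) /=.
  rewrite -big_distrlr /= !sum_sign_bit card_ord !(mulrnAl, mulrnAr) -mulrnA mulnb.
  rewrite mulrNN mulrACA -exprMn -natrM -invfM -natrM mulrC.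
  by rewrite andbC {3}[ij]surjective_pairing xpair_eqE.
under eq_bigr do under eq_bigr do rewrite inner.
rewrite (bigD1 ij.1)//= (bigD1 ij.2)//= -surjective_pairing eqxx.
rewrite big1 ?addr0 => [|j jN]; last first.
  by rewrite [in X in _ *+ X](surjective_pairing ij) xpair_eqE [ij.2 == j]eq_sym (negbTE jN) andbF.
rewrite big1 ?addr0// => i iN; rewrite big1// => j _.
by rewrite [in X in _ *+ X](surjective_pairing ij) xpair_eqE [ij.1 == i]eq_sym (negbTE iN).
Qed.

End Bessel.

(** Since [flip i] permutes the [X], the terms [e (flip i X) i] and [e X i] have the same sum over
    [X]. Summing the lower bound over all [X] and [i] therefore compares it with [A]. *)
Lemma flip_average {R : realFieldType} {I : finType}
    (e : {ffun I -> bool} -> I -> R) (A C : R) : 0 <= C ->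
  (forall X, \sum_i e X i <= A) ->
  (forall X i, 2^-1 <= e X i + C * e (flip i X) i) ->
  #|I|%:R / 2 <= (1 + C) * A.
Proof.
move=> C0 eA eC; pose N : R := #|{ffun I -> bool}|%:R.
have N0 : 0 < N by rewrite ltr0n card_ffun card_bool expn_gt0.
have -> : (1 + C) * A = (1 + C) * (N * A) / N by rewrite mulrCA mulrAC divff ?mul1r ?gt_eqF// mulrC.
rewrite ler_pdivlMr//.
have sumA : \sum_X \sum_i e X i <= N * A.
  by rewrite /N mulr_natl -sumr_const; apply: ler_sum.
apply: (@le_trans _ _ ((1 + C) * \sum_X \sum_i e X i)); last first.
  by rewrite ler_pM2l// ltr_wpDr.
have -> : (1 + C) * (\sum_X \sum_i e X i) = \sum_i \sum_X (e X i + C * e (flip i X) i).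
  rewrite exchange_big big_distrr /=; apply: eq_bigr => i _.
  rewrite big_split mulrDl mul1r /= -big_distrr /=; congr (_ + C * _).
  by rewrite [LHS](reindex_inj (inv_inj (flipK i))).
rewrite -(_ : \sum_(i : I) \sum_(X : {ffun I -> bool}) 2^-1 = #|I|%:R / 2 * N).
  by apply: ler_sum => i _; apply: ler_sum => X _.
by rewrite !sumr_const -(mulr_natl (2^-1 *+ _)) -(mulr_natr 2^-1) mulrA.
Qed.

Lemma map_enum_val_enum (V : finType) : [seq enum_val i | i <- enum 'I_#|V|] = enum V.
Proof.
rewrite -[RHS](map_tnth_enum (enum_tuple V)); apply: eq_map => i.
by rewrite (tnth_nth (enum_val i)) -enum_val_nth.
Qed.

(** * Answering all queries from one common sample of reports *)

Section Reconstruction.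
Context {k m : nat}.
Let V : finType := ('I_k * 'I_m)%type.
Let Q : finType := ({ffun 'I_m -> bool} * {ffun 'I_m -> bool})%type.
Implicit Types (X : {ffun 'I_m * 'I_m -> bool}) (q : Q) (v w : V) (ij : 'I_m * 'I_m).

Definition query_graph X q : rel V := Gedge (fun i j => X (i, j)) q.1 q.2.

(* The part of the query (mu, ups) that node v sees; two queries that agree on
   it are answered by v with the same report. *)
Definition view v q : Q :=
  if v.1 == 0 :> nat then ([ffun=> q.1 v.2], [ffun=> false])
  else if v.1 == 1 :> nat then ([ffun=> false], [ffun=> q.2 v.2])
  else q.

Lemma view_idem v q : view v (view v q) = view v q.
Proof.
case: v => -[[|[|p]] hp] i; rewrite /view //=; congr (_, _); apply/ffunP => l.
all: by rewrite !ffunE.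
Qed.

Lemma adj_vec_view X v q : adj_vec (query_graph X (view v q)) v = adj_vec (query_graph X q) v.
Proof.
apply/ffunP => -[r l]; rewrite !ffunE /query_graph /Gedge /view; case: v => p i /=.
by case: p => -[|[|p]] hp //=; do ?case: ifP => //=; rewrite ?ffunE.
Qed.

(* Slot (v, c) holds the report that v would send on query c. *)
Definition slots : seq (V * Q) := [seq (v, c) | v <- enum V, c <- enum Q].

Definition used q (s : V * Q) : bool := s.2 == view s.1 q.

Lemma slots_uniq : uniq slots.
Proof. by apply: allpairs_uniq; rewrite ?enum_uniq// => -[v c] [v' c'] _ _ /= [-> ->]. Qed.

Lemma filter_slots q : [seq s <- slots | used q s] = [seq (v, view v q) | v <- enum V].
Proof.
rewrite /slots; elim: (enum V) => [//|v vs IH] /=.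
rewrite filter_cat IH filter_map (eq_filter (_ : _ =1 pred1 (view v q)))//.
by rewrite filter_pred1_uniq ?enum_uniq ?mem_enum.
Qed.

Lemma graph_flip X ij q v w :
  (query_graph X q v w != query_graph (flip ij X) q v w) =
  [|| [&& v.1 == 0 :> nat, v.2 == ij.1, w.1 == 1 :> nat & w.2 == ij.2]
    | [&& v.1 == 1 :> nat, v.2 == ij.2, w.1 == 0 :> nat & w.2 == ij.1]].
Proof.
case: ij v w => i j [p a] [r b]; rewrite /query_graph /Gedge /= !ffunE !xpair_eqE.
case: p r => [[|[|p]] hp] [[|[|r]] hr] //=; rewrite ?eqxx ?andbF ?andbT ?orbF //=.
- by case: (X _); case: (a == i); case: (b == j).
- by case: (X _); case: (b == i); case: (a == j).
Qed.

Context {R : realType} {d : measure_display} {T : measurableType d}.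
Variables (eps : R) (L : V -> {ffun V -> bool} -> probability T R).
Variable g : #|V|.-tuple T -> R.

(* The law of a slot is made independent of X on slots that no query uses. *)
Definition slot_law X (s : V * Q) : probability T R :=
  L s.1 (adj_vec (query_graph (if view s.1 s.2 == s.2 then X else [ffun=> false]) s.2) s.1).

(** The value 0 is a default for lists whose length is not the number of nodes. *)
Definition server (s : seq T) : R :=
  if @insub _ _ (#|V|.-tuple T) s is Some t then g t else 0.

Definition answer q (s : seq T) : R := server (mask [seq used q x | x <- slots] s).

(** Query [q] reads exactly the slots [(v, view v q)], whose laws are those of the true reports
    because [view] is idempotent and preserves the adjacency vector of [v]. The other slots
    integrate out, so one product law serves every query. *)
Lemma expected_sq_error_slots X q (K : R) :
  expected_sq_error (query_graph X q) L g K =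
  iter_int [seq slot_law X s | s <- slots] (fun s => ((answer q s - K) ^+ 2)%:E).
Proof.
rewrite /expected_sq_error.
rewrite -(iter_int_filter (slot_law X) (used q) slots (fun s => ((server s - K) ^+ 2)%:E)).
have -> : [seq slot_law X s | s <- slots & used q s] =
    [seq L (enum_val i) (adj_vec (query_graph X q) (enum_val i)) | i <- enum 'I_#|V|].
  rewrite filter_slots -map_comp [RHS](map_comp (fun v => L v (adj_vec (query_graph X q) v)) enum_val).
  rewrite map_enum_val_enum; apply: eq_map => v /=.
  by rewrite /slot_law /= view_idem eqxx adj_vec_view.
apply: iter_int_ext => s; rewrite size_map size_enum_ord => ss.
by rewrite /server; case: insubP => //; rewrite ss eqxx.
Qed.

(** * Privacy of the sample against the accuracy of the reconstruction *)

Hypothesis k3 : (3 <= k)%N.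
Hypothesis LDP : forall v, edge_LDP eps (L v).
Hypothesis eps0 : 0 < eps.
Hypothesis mg : measurable_fun [set: #|V|.-tuple T] g.

Let part0 : 'I_k := Ordinal (ltnW (ltnW k3)).
Let part1 : 'I_k := Ordinal (ltnW k3).

Definition silent : {ffun 'I_m -> bool} := [ffun=> false].

(* Flipping X_ij changes the adjacency vectors of u_i and y_j only, and each of
   these two nodes has two slots in use. *)
Definition affected ij (s : V * Q) : bool :=
  ((s.1.1 == 0 :> nat) && (s.1.2 == ij.1) || (s.1.1 == 1 :> nat) && (s.1.2 == ij.2))
  && (view s.1 s.2 == s.2).

Lemma count_affected ij : (count (affected ij) slots <= 4)%N.
Proof.
pose cst_bit (b : bool) : {ffun 'I_m -> bool} := [ffun=> b].
pose u : V := (part0, ij.1); pose y : V := (part1, ij.2).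
pose l : seq (V * Q) :=
  [:: (u, (cst_bit false, silent)); (u, (cst_bit true, silent));
      (y, (silent, cst_bit false)); (y, (silent, cst_bit true))].
rewrite -size_filter -[4%N]/(size l); apply: uniq_leq_size.
  by rewrite filter_uniq// slots_uniq.
move=> [[p a] [mu ups]]; rewrite mem_filter => /andP[/andP[/= part /eqP <-] _].
case/orP: part => /andP[/eqP p0 /eqP ->].
  have -> : p = part0 by apply/val_inj.
  by rewrite /view /= !inE /u /cst_bit /silent; case: (mu ij.1); rewrite !eqxx ?orbT.
have -> : p = part1 by apply/val_inj.
by rewrite /view /= !inE /y /cst_bit /silent; case: (ups ij.2); rewrite !eqxx ?orbT.
Qed.

Lemma slot_law_flip X ij s (S : set T) : measurable S ->
  (slot_law X s S <= (if affected ij s then expR eps else 1)%:E * slot_law (flip ij X) s S)%E.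
Proof.
move=> mS; rewrite /slot_law /affected; case: ifPn => [vs|_]; last by rewrite andbF mul1e.
rewrite andbT; case: ifPn => [/orP sij|sij].
  (* The single changed bit is at the other endpoint of the flipped pair: y_j as seen from u_i, and
     u_i as seen from y_j. *)
  have [w0 w0P] : exists w0, forall w,
      query_graph X s.2 s.1 w != query_graph (flip ij X) s.2 s.1 w = (w == w0).
    case: sij => /andP[s1 s2]; [exists (part1, ij.2) | exists (part0, ij.1)] => -[p i].
      by rewrite graph_flip s1 s2 (eqP s1) /= orbF.
    by rewrite graph_flip s1 s2 (eqP s1).
  apply: LDP => //; rewrite /neighboring -(cards1 w0); congr #|pred_of_set _|.
  by apply/setP => w; rewrite !inE !ffunE.
rewrite mul1e (_ : adj_vec (query_graph (flip ij X) s.2) s.1 = adj_vec (query_graph X s.2) s.1)//.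
apply/ffunP => w; rewrite !ffunE; apply/esym/eqP/negPn; rewrite graph_flip.
by apply: contra sij => /orP[] /and4P[-> -> _ _] /=; rewrite ?orbT.
Qed.

(** Each affected slot costs a factor e^eps and every other slot a factor 1; at most four slots are
    affected. *)
Lemma iter_int_slots_flip X ij (f : seq T -> \bar R) :
  (forall s, 0 <= f s)%E -> smeasurable (size slots) f ->
  (iter_int [seq slot_law X s | s <- slots] f <=
   (expR eps ^+ 4)%:E * iter_int [seq slot_law (flip ij X) s | s <- slots] f)%E.
Proof.
move=> f0 mf.
apply: le_trans (iter_int_le_scale _ (slot_law (flip ij X))
  (fun s => if affected ij s then expR eps else 1) _ _ _ _ f0 mf) _.
- by move=> s; case: ifP => _; rewrite ?expR_ge0.
- by move=> s S; exact: slot_law_flip.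
apply: lee_wpmul2r; first exact: iter_int_ge0.
rewrite lee_fin -big_mkcond big_const_seq iter_mulr_1 /=.
by rewrite ler_weXn2l ?count_affected// -expR0 ler_expR ltW.
Qed.

Lemma smeasurable_answer q :
  measurable_fun [set: (size slots).-tuple T] (fun t : (size slots).-tuple T => answer q t).
Proof.
apply/measurable_EFinP.
have mserver : smeasurable #|V| (fun s => (server s)%:E).
  apply/measurable_EFinP; rewrite (_ : (fun t : #|V|.-tuple T => _) = g)//.
  by apply/funext => t; rewrite /server valK.
have := @smeasurable_mask R d T [seq used q s | s <- slots] (fun s => (server s)%:E).
rewrite size_map count_map (eq_count (_ : _ =1 used q))// -size_filter filter_slots.
by rewrite size_map -cardE; apply.
Qed.

(* 4 E[(-1)^(mu_i) (-1)^(ups_j) mu^T X ups] = X_ij for uniform mu and ups. *)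
Definition estimate ij (s : seq T) : R :=
  4 / (4 ^+ m * (m ^ (k - 2))%:R) * \sum_q outer_sign ij q * answer q s.

Lemma smeasurable_estimate ij (c : R) :
  smeasurable (size slots) (fun s => ((estimate ij s - c) ^+ 2)%:E).
Proof.
apply/measurable_EFinP; apply: measurable_funX; apply: measurable_funB => //.
apply: measurable_funM => //; apply: measurable_sum => q.
by apply: measurable_funM => //; exact: smeasurable_answer.
Qed.

(** By [outer_sign_query], the error of [estimate ij] is a fixed multiple of the coefficient of the
    answer error [D] along [outer_sign ij]. Bessel's inequality with [N] equal to 4^m bounds the sum
    of the squares. *)
Lemma estimate_error X s : (0 < m)%N ->
  \sum_ij (estimate ij s - (X ij)%:R) ^+ 2 <=
  16 / (4 ^+ m * (m ^ (k - 2))%:R ^+ 2) *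
  \sum_q (answer q s - (num_cliques (query_graph X q) k)%:R) ^+ 2.
Proof.
move=> m0; pose M : R := (m ^ (k - 2))%:R; rewrite -/M.
have M0 : M != 0 by rewrite pnatr_eq0 -lt0n expn_gt0 m0.
have F0 : 4 ^+ m != 0 :> R by rewrite expf_neq0.
pose D q := answer q s - (num_cliques (query_graph X q) k)%:R.
have errE ij : estimate ij s - (X ij)%:R = 4 / (4 ^+ m * M) * \sum_q outer_sign ij q * D q.
  under [in RHS]eq_bigr do rewrite mulrBr num_cliques_Gedge// natrM mulrCA.
  rewrite sumrB -big_distrr /= outer_sign_query mulrBr -/M; congr (_ - _).
  by field; rewrite F0 M0.
under eq_bigr do rewrite errE exprMn.
rewrite -big_distrr /= (_ : 16 / _ = (4 / (4 ^+ m * M)) ^+ 2 * 4 ^+ m); last first.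
  by field; rewrite F0 M0.
rewrite -mulrA ler_pM2l ?exprn_gt0 ?divr_gt0 ?mulr_gt0 ?exprn_gt0 ?ltr0n ?expn_gt0 ?m0//.
by apply: bessel (outer_sign_orthogonal); rewrite exprn_gt0.
Qed.

Lemma expected_sq_error_lower_bound (B : R) : (0 < m)%N ->
  (forall X q, (expected_sq_error (query_graph X q) L g (num_cliques (query_graph X q) k)%:R <= B%:E)%E) ->
  (m ^ 2)%:R / 2 <= (1 + expR eps ^+ 4) * (16 * B / (m ^ (k - 2))%:R ^+ 2).
Proof.
move=> m0 err; pose M : R := (m ^ (k - 2))%:R; rewrite -/M.
have M0 : 0 < M by rewrite ltr0n expn_gt0 m0.
pose E X ij (c : bool) :=
  iter_int [seq slot_law X s | s <- slots] (fun s => ((estimate ij s - c%:R) ^+ 2)%:E).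
have E0 X ij c : (0 <= E X ij c)%E by apply: iter_int_ge0 => s; rewrite lee_fin sqr_ge0.
have mE X ij c : smeasurable (size [seq slot_law X s | s <- slots])
    (fun s => ((estimate ij s - c) ^+ 2)%:E).
  by rewrite size_map; exact: smeasurable_estimate.
(* Integrate [estimate_error]: each of the 4^m queries contributes at most [B], and 4^m cancels. *)
have sumE X : (\sum_ij E X ij (X ij) <= (16 * B / M ^+ 2)%:E)%E.
  pose K q : R := (num_cliques (query_graph X q) k)%:R.
  have mA q : smeasurable (size [seq slot_law X s | s <- slots])
      (fun s => ((answer q s - K q) ^+ 2)%:E).
    rewrite size_map; apply/measurable_EFinP; apply: measurable_funX.
    by apply: measurable_funB => //; exact: smeasurable_answer.
  rewrite -(ge0_iter_int_sum _ _ (fun ij s => ((estimate ij s - (X ij)%:R) ^+ 2)%:E))//; last first.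
    by move=> ij s; rewrite lee_fin sqr_ge0.
  pose c : R := 16 / (4 ^+ m * M ^+ 2).
  have c0 : 0 <= c by rewrite divr_ge0 ?mulr_ge0 ?exprn_ge0 ?ltW.
  have sum0 s : (0 <= \sum_q ((answer q s - K q) ^+ 2)%:E)%E.
    by apply: sume_ge0 => q _; rewrite lee_fin sqr_ge0.
  apply: (@le_trans _ _ (iter_int [seq slot_law X s | s <- slots]
      (fun s => c%:E * \sum_q ((answer q s - K q) ^+ 2)%:E))%E).
    apply: ge0_le_iter_int => [s|||s].
    - by apply: sume_ge0 => ij _; rewrite lee_fin sqr_ge0.
    - by apply: emeasurable_sum => ij; exact: mE.
    - by apply: measurable_funeM; exact: emeasurable_sum.
    - by rewrite !sumEFin -EFinM lee_fin; exact: estimate_error.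
  rewrite ge0_iter_intZl//; last exact: emeasurable_sum.
  rewrite ge0_iter_int_sum//; last by move=> q s; rewrite lee_fin sqr_ge0.
  apply: (@le_trans _ _ (c%:E * \sum_(q : Q) B%:E)%E).
    apply: lee_wpmul2l; first by rewrite lee_fin.
    by apply: lee_sum => q _; rewrite -expected_sq_error_slots.
  rewrite sumEFin -EFinM lee_fin sumr_const card_prod !card_ffun card_bool card_ord.
  rewrite -expnMn -[B *+ _]mulr_natr natrX (_ : (2 * 2)%:R = 4 :> R)//.
  rewrite /c le_eqVlt; apply/orP; left; apply/eqP; field.
  by rewrite (gt_eqF M0) expf_neq0.
(* Finiteness of the total makes each error finite, so that [flip_average] applies to real
   values. *)
have finE X ij : E X ij (X ij) \is a fin_num.
  rewrite ge0_fin_numE//; apply: le_lt_trans (ltry (16 * B / M ^+ 2)).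
  apply: le_trans (sumE X); rewrite (bigD1 ij)//= leeDl//.
  by apply: sume_ge0 => t _; exact: E0.
pose e X ij := fine (E X ij (X ij)).
rewrite -(_ : #|{: 'I_m * 'I_m}| = m ^ 2)%N; last by rewrite card_prod card_ord.
apply: (flip_average e); first by rewrite exprn_ge0 ?expR_ge0.
  move=> X; rewrite -lee_fin -sumEFin.
  by under eq_bigr do rewrite fineK//; exact: sumE.
move=> X ij; rewrite -lee_fin EFinD EFinM !fineK//.
have flipE : (flip ij X) ij = ~~ X ij by rewrite ffunE eqxx.
rewrite flipE.
(* The target [~~ X ij] is the true bit of [flip ij X]. Transporting its error back to the law of
   [X] confronts one law with both targets 0 and 1. *)
have := iter_int_slots_flip X ij (fun s => ((estimate ij s - (~~ X ij)%:R) ^+ 2)%:E).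
rewrite -/(E X ij (~~ X ij)) -/(E (flip ij X) ij (~~ X ij)) => le_flip.
apply: (@le_trans _ _ (E X ij (X ij) + E X ij (~~ X ij))%E); last first.
  apply: leeD2l; apply: le_flip => [s|]; first by rewrite lee_fin sqr_ge0.
  exact: smeasurable_estimate.
rewrite /E -ge0_iter_intD//; try by move=> s; rewrite lee_fin sqr_ge0.
rewrite -[leLHS](iter_int_cst [seq slot_law X s | s <- slots]).
apply: ge0_le_iter_int => [s|||s].
- by rewrite lee_fin invr_ge0.
- exact: measurable_cst.
- by apply: emeasurable_funD; exact: mE.
rewrite -EFinD lee_fin; set z := estimate ij s.
(* No [z] is close to both bits: z^2 + (z - 1)^2 = ((2z - 1)^2 + 1) / 2. *)
by case: (X ij) => /=; have := sqr_ge0 (2 * z - 1); nra.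
Qed.

End Reconstruction.

(* n = 3 m, the graph has k * m nodes.  For every family (indexed by m) *)
(* of non-interactive eps-edge LDP algorithms, the worst-case expected  *)
(* l2-error over all X, mu, ups is NOT o((k m)^(k-1)) as m -> oo.       *)
(* (l2-error <= c N^(k-1) is written as squared error <= (c N^(k-1))^2.) *)
Theorem theorem2 (R : realType) (k : nat) (hk : (3 <= k)%N) (eps : R)
  (heps : 0 < eps)
  (d : nat -> measure_display) (T : forall m : nat, measurableType (d m))
  (L : forall m : nat, 'I_k * 'I_m -> {ffun 'I_k * 'I_m -> bool} -> probability (T m) R)
  (g : forall m : nat, #|{: 'I_k * 'I_m}|.-tuple (T m) -> R) :
  (forall (m : nat) (v : 'I_k * 'I_m), edge_LDP eps (L m v)) ->
  (forall m : nat, measurable_fun [set: #|{: 'I_k * 'I_m}|.-tuple (T m)] (g m)) ->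
  ~ (forall c : R, 0 < c ->
       exists M : nat, forall m : nat, (M <= m)%N ->
         forall (X : 'I_m -> 'I_m -> bool) (mu ups : 'I_m -> bool),
           (expected_sq_error (@Gedge k m X mu ups) (L m) (g m)
              (num_cliques (@Gedge k m X mu ups) k)%:R
            <= ((c * ((k * m)%N)%:R ^+ (k - 1)) ^+ 2)%:E)%E).
Proof.
move=> LDP mg small; pose C : R := 1 + expR eps ^+ 4.
have C1 : 1 <= C by rewrite lerDl exprn_ge0 ?expR_ge0.
have C0 : 0 < C by exact: lt_le_trans C1.
pose P : R := k%:R ^+ (k - 1).
have P0 : 0 < P by rewrite exprn_gt0// ltr0n (leq_trans _ hk).
(* This choice of c turns the lower bound into m^2 / 2 <= m^2 / (4 C), which is false as C >= 1. *)
have c0 : 0 < (8 * C * P)^-1 by rewrite invr_gt0 !mulr_gt0.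
have [M0 /(_ M0.+1 (leqnSn _)) err] := small _ c0.
(* The successor of the threshold guarantees a positive [m]. *)
set m := M0.+1 in err; have m0 : (0 < m)%N by [].
have := @expected_sq_error_lower_bound k m _ _ _ eps (L m) (g m) hk (LDP m) heps (mg m)
  _ m0 (fun X q => err (fun i j => X (i, j)) q.1 q.2).
pose N : R := (m ^ (k - 2))%:R; rewrite -/N -/C.
have N0 : 0 < N by rewrite ltr0n expn_gt0.
have -> : (k * m)%:R ^+ (k - 1) = P * (m%:R * N) :> R.
  rewrite natrM exprMn -/P /N natrX -exprS; congr (_ * _ ^+ _).
  by case: (k) hk => [|[|[|]]].
have -> : C * (16 * ((8 * C * P)^-1 * (P * (m%:R * N))) ^+ 2 / N ^+ 2)
    = (m ^ 2)%:R / 2 / (2 * C).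
  by rewrite natrX; field; rewrite !gt_eqF.
have m20 : 0 < (m ^ 2)%:R / 2 :> R by rewrite divr_gt0// ltr0n expn_gt0.
rewrite leNgt ltr_pdivrMr ?mulr_gt0// ltr_pMr//.
by lra.
Qed.
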